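(* Let $(X,d)$ be a complete metric space with $|X|\geqslant 3$, and let the mapping $T\colon X\to X$ satisfy the following two conditions: (i) $T$ does not possess periodic points of prime period $2$; (ii) $T$ is a generalized Chatterjea type mapping on $X$. Then $T$ has a fixed point, and the number of fixed points of $T$ is at most two.
   Context: For a metric space $(X,d)$ with $|X|\geqslant 3$, a mapping $T\colon X\to X$ is called a generalized Chatterjea type mapping on $X$ if there exists $\gamma\in[0,\frac13)$ such that $$d(Tx,Ty)+d(Ty,Tz)+d(Tx,Tz)\leqslant \gamma\,(d(x,Ty)+d(x,Tz)+d(y,Tx)+d(y,Tz)+d(z,Tx)+d(z,Ty))$$ holds for all three pairwise distinct points $x,y,z\in X$. A point $x\in X$ is a periodic point of prime period $2$ of $T$ if $T(Tx)=x$ and $Tx\neq x$. *)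

(* Defs.v *)
From HB Require Import structures.
From mathcomp Require Import all_boot all_order all_algebra.
From mathcomp Require Import all_classical all_reals all_analysis.

Set Implicit Arguments.
Unset Strict Implicit.
Unset Printing Implicit Defensive.

Import Order.TTheory GRing.Theory Num.Theory.

Local Open Scope classical_set_scope.
Local Open Scope ring_scope.

(* Completeness is that of the uniformity of [mdist]: every Cauchy proper
   filter converges. The base point that [Complete] carries is harmless for
   the nonempty spaces considered here. *)
#[short(type="completeMetricType")]
HB.structure Definition CompleteMetric (K : numDomainType) :=
  {M of Complete M & Metric K M}.

Definition generalized_chatterjea (R : realType) (X : metricType R)
    (T : X -> X) : Prop :=
  exists2 gamma : R, 0 <= gamma < 1 / 3 &
    forall x y z : X, x <> y -> y <> z -> x <> z ->
      mdist (T x) (T y) + mdist (T y) (T z) + mdist (T x) (T z) <=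
      gamma * (mdist x (T y) + mdist x (T z) + mdist y (T x) +
               mdist y (T z) + mdist z (T x) + mdist z (T y)).

Definition periodic_point2 (X : Type) (T : X -> X) (x : X) : Prop :=
  T (T x) = x /\ T x <> x.

Definition fixed_points (X : Type) (T : X -> X) : set X := [set x | T x = x].

(* Main.v *)
(* The inequality is only used with gamma replaced by 1/3. If T has no fixed
   point, three consecutive points of an orbit (u n) are pairwise distinct,
   since there is no point of prime period 2. The inequality together with
   d(u_n, u_(n+3)) <= d(u_n, u_(n+2)) + d(u_(n+2), u_(n+3)) then gives
   p_(n+1) <= d(u_n, u_(n+2)) <= p_n / 2 for the perimeter p_n of the triangle
   u_n, u_(n+1), u_(n+2), so the orbit is Cauchy. Applied to u_n, u_(n+1) and
   the limit x, the inequality yields 2 d(x, Tx) <= (2/3) d(x, Tx) as n grows.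
   For three distinct fixed points spanning a triangle of perimeter s it reads
   s <= 2 s / 3. *)
Require Import Defs.
From mathcomp Require Import all_boot all_order all_algebra.
From mathcomp Require Import all_classical all_reals all_analysis.
From mathcomp Require Import lra.

Local Open Scope classical_set_scope.
Local Open Scope card_scope.

Import Order.TTheory GRing.Theory Num.Theory.

Lemma card_le_II2 (X : Type) (A : set X) :
  (forall x y z, A x -> A y -> A z -> [\/ x = y, y = z | x = z]) ->
  A #<= `I_2.
Proof.
move=> A3; have [->|/set0P[a Aa]] := eqVneq A set0; first exact: card_ge0.
have [b Ab Aab] : exists2 b, A b & forall c, A c -> c = a \/ c = b.
  have [[b Ab ba]|noB] := pselect (exists2 b, A b & b <> a).
    by exists b => // c Ac; case: (A3 a b c Aa Ab Ac) => [||] e; subst; auto.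
  (* When [A] is the singleton of [a], the second value [b] is [a] again. *)
  exists a => // c Ac; left; apply: contrapT => ca; apply: noB.
  by exists c.
pose f n := if n is 0 then a else b.
apply: (card_le_trans _ (card_image_le f `I_2)); apply: subset_card_le => c Ac.
by case: (Aab c Ac) => ->; [exists 0%N|exists 1%N].
Qed.

Local Open Scope ring_scope.

(** The number [p n] bounds the distance from [u n] to every later term, because
    [p n / 2 + p n.+1 <= p n]. Hence the tail from [N] lies in the ball of radius [e] around [u N]
    once [p N < e]. *)
Lemma halving_steps_cauchy {R : realType} {X : metricType R}
    (u : nat -> X) (p : nat -> R) :
  (forall n, mdist (u n) (u n.+1) <= p n / 2) ->
  (forall n, p n.+1 <= p n / 2) ->
  cauchy (u @ \oo).
Proof.
move=> step halve; apply: cauchy_exP => e e0.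
have p0 n : 0 <= p n by have := step n; have := mdist_ge0 (u n) (u n.+1); lra.
have dist_le n k : mdist (u n) (u (n + k)%N) <= p n.
  (* The induction peels off the first step, so its hypothesis is used at [n.+1]. *)
  elim: k n => [|k IHk] n; first by rewrite addn0 mdistxx.
  rewrite addnS -addSn.
  have := metric_triangle (u n) (u n.+1) (u (n.+1 + k)%N).
  have := IHk n.+1; have := step n; have := halve n; lra.
have p_le n : p n <= geometric (p 0%N) 2^-1 n.
  elim: n => [|n IHn]; first by rewrite /= expr0 mulr1.
  by apply: le_trans (halve n) _; rewrite /= exprSr mulrA ler_wpM2r.
have [N pN] : exists N, p N < e.
  have half1 : `|2^-1 : R| < 1 by rewrite ger0_norm; lra.
  have /cvgr0Pnorm_lt/(_ _ e0)[N _ /(_ N (leqnn N)) /= gN] :=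
    cvg_geometric (p 0%N) half1.
  by exists N; apply: le_lt_trans (p_le N) (le_lt_trans (ler_norm _) gN).
exists (u N), N => // n /= Nn; rewrite ballEmdist /=.
by rewrite -(subnKC Nn); apply: le_lt_trans (dist_le _ _) pN.
Qed.

Section GeneralizedChatterjea.
Context {R : realType} {X : metricType R} (T : X -> X).
Hypothesis contraction : forall x y z : X, x <> y -> y <> z -> x <> z ->
  mdist (T x) (T y) + mdist (T y) (T z) + mdist (T x) (T z) <=
  (mdist x (T y) + mdist x (T z) + mdist y (T x) +
   mdist y (T z) + mdist z (T x) + mdist z (T y)) / 3.

Lemma chatterjea_fixed_points_le2 : fixed_points T #<= `I_2.
Proof.
apply: card_le_II2 => x y z Tx Ty Tz.
have [|xy] := pselect (x = y); first exact: Or31.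
have [|yz] := pselect (y = z); first exact: Or32.
have [|xz] := pselect (x = z); first exact: Or33.
have := contraction x y z xy yz xz; rewrite Tx Ty Tz.
rewrite (metric_sym y x) (metric_sym z x) (metric_sym z y).
have : 0 < mdist x y by rewrite mdist_gt0; apply/eqP.
have := mdist_ge0 y z; have := mdist_ge0 x z.
lra.
Qed.

Let perimeter x := mdist x (T x) + mdist (T x) (T (T x)) + mdist x (T (T x)).

(** After the triangle inequality the right side is a third of
    [2 * mdist x (T (T x)) + perimeter (T x)]; its perimeter term is absorbed on the left. *)
Lemma chatterjea_perimeter_halves x : x <> T x -> T x <> T (T x) ->
  x <> T (T x) -> perimeter (T x) <= perimeter x / 2.
Proof.
move=> d1 d2 d3; have := contraction x (T x) (T (T x)) d1 d2 d3.
rewrite /perimeter !mdistxx (metric_sym (T (T x)) (T x)).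
have := metric_triangle x (T (T x)) (T (T (T x))).
have := metric_triangle x (T x) (T (T x)).
lra.
Qed.

Lemma chatterjea_orbit_limit_fixed (x0 x : X) :
  (forall n, iter n T x0 <> iter n.+1 T x0) ->
  (forall n, iter n T x0 <> iter n.+2 T x0) ->
  iter n T x0 @[n --> \oo] --> x -> T x = x.
Proof.
move=> d1 d2 cvg_x; apply: contrapT => Txx.
have D0 : 0 < mdist x (T x) by rewrite mdist_gt0; apply/eqP => /esym.
(* If three consecutive terms are within [e] of [x], the inequality gives
   [4/3 * mdist x (T x) < 10/3 * e], which is false for [e] a quarter of [mdist x (T x)]. *)
have e0 : 0 < mdist x (T x) / 4 by lra.
have [N _ closeN] := metricType_numDomainType.cvgr_dist_lt cvg_x e0.
(* The inequality needs [x] distinct from both terms. Terms one or two steps apart differ, so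
   starting just after a visit to [x] avoids [x] twice. *)
have [n Nn [xn xn1]] : exists2 n, (N <= n)%N &
    iter n T x0 <> x /\ iter n.+1 T x0 <> x.
  have [xN|xN] := pselect (iter N T x0 = x).
    exists N.+1 => //; rewrite -xN; split; [exact/nesym/d1|exact/nesym/d2].
  have [xN1|xN1] := pselect (iter N.+1 T x0 = x); last by exists N.
  exists N.+2; first by rewrite ltnW.
  by rewrite -xN1; split; [exact/nesym/d1|exact/nesym/d2].
have := closeN n Nn; have := closeN n.+1 (leqW Nn).
have := closeN n.+2 (leqW (leqW Nn)).
have := contraction _ _ _ (d1 n) xn1 xn.
rewrite /=; move: (iter n T x0) => y; rewrite mdistxx.
have := metric_triangle x (T y) (T x).
have := metric_triangle x (T (T y)) (T x).
have := metric_triangle y x (T x); rewrite (metric_sym y x).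
have := metric_triangle (T y) x (T x); rewrite (metric_sym (T y) x).
have := metric_triangle y x (T (T y)); rewrite (metric_sym y x).
have := mdist_ge0 (T y) (T (T y)).
lra.
Qed.

End GeneralizedChatterjea.

Theorem theorem3p1 (R : realType) (X : completeMetricType R) (T : X -> X)
    (card_X : `I_3 #<= [set: X])
    (no_period2 : ~ exists x, periodic_point2 T x)
    (chatterjea_T : generalized_chatterjea T) :
  fixed_points T !=set0 /\ fixed_points T #<= `I_2.
Proof.
have [gamma /andP[_ gamma_lt] contraction_gamma] := chatterjea_T.
have contraction : forall x y z : X, x <> y -> y <> z -> x <> z ->
    mdist (T x) (T y) + mdist (T y) (T z) + mdist (T x) (T z) <=
    (mdist x (T y) + mdist x (T z) + mdist y (T x) +
     mdist y (T z) + mdist z (T x) + mdist z (T y)) / 3.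
  move=> x y z xy yz xz.
  apply: le_trans (contraction_gamma x y z xy yz xz) _.
  rewrite [leRHS]mulrC -div1r.
  by rewrite ler_wpM2r ?(ltW gamma_lt)// !addr_ge0 ?mdist_ge0.
split; last exact: chatterjea_fixed_points_le2 contraction.
apply: contrapT => nofix.
have d1 x : x <> T x by move=> Tx; apply: nofix; exists x.
have d2 x : x <> T (T x).
  by move=> TTx; apply: no_period2; exists x; split=> // /esym/d1.
pose u n := iter n T point.
pose p x := mdist x (T x) + mdist (T x) (T (T x)) + mdist x (T (T x)).
have /cauchy_cvg cvg_u : cauchy (u @ \oo).
  apply: (halving_steps_cauchy u (fun n => p (u n))) => n.
    rewrite /p /u /=; set x := iter n T _.
    (* A side of a triangle is at most half its perimeter. *)
    have := metric_triangle x (T (T x)) (T x).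
    by rewrite (metric_sym (T (T x)) (T x)); lra.
  exact: chatterjea_perimeter_halves contraction _ (d1 _) (d1 _) (d2 _).
apply: nofix; exists (lim (u @ \oo)).
by apply: chatterjea_orbit_limit_fixed contraction _ _ _ _ cvg_u => n;
  [exact: d1|exact: d2].
Qed.
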